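(* Let $r\ge 2$ be an integer, let $(\mathsf e_1,\ldots,\mathsf e_r)$ denote the standard basis of $\mathbb Z^r$, let $G_r^+=\{\sum_{i=1}^r\epsilon_i\mathsf e_i:\epsilon_i\in\{0,1\},\text{ not all }\epsilon_i=0\}$, and let $G_0=G_r^+\cup -G_r^+$. Then $$\mathsf F_{r+2}\;\le\;\mathsf D(G_0)\;\le\;\frac{2^r-r-1}{2^r}\,(r+2)^{\frac{r+2}{2}}\;\le\;(r+2)^{\frac{r+2}{2}},$$ where $\mathsf F_n$ denotes the $n$-th Fibonacci number.
   Context: Fibonacci numbers: $\mathsf F_0=0$, $\mathsf F_1=1$, $\mathsf F_n=\mathsf F_{n-1}+\mathsf F_{n-2}$ for $n\ge 2$. For a subset $G_0$ of an additive abelian group, a sequence over $G_0$ is a finite unordered sequence of elements of $G_0$ with repetition allowed (a finite multiset). It is a zero-sum sequence if the sum of its terms (with multiplicity) is $0$. A minimal zero-sum sequence is a nonempty zero-sum sequence having no proper nonempty zero-sum subsequence. The Davenport constant $\mathsf D(G_0)\in\mathbb N_0\cup\{\infty\}$ is the supremum of the lengths (numbers of terms counted with multiplicity) of all minimal zero-sum sequences over $G_0$. *)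

(* Defs.v *)
From HB Require Import structures.
From mathcomp Require Import all_boot all_order all_algebra.
From mathcomp Require Import finmap multiset.
From mathcomp Require Import all_classical all_reals all_analysis.

Set Implicit Arguments.
Unset Strict Implicit.
Unset Printing Implicit Defensive.

Import Order.TTheory GRing.Theory Num.Theory.

Local Open Scope classical_set_scope.
Local Open Scope ring_scope.

Fixpoint fib (n : nat) : nat :=
  match n with
  | 0%N => 0%N
  | 1%N => 1%N
  | (m.+1 as k).+1 => (fib k + fib m)%N
  end.

(* A sequence over G0 is a finite multiset; the coercion of a multiset to [seq]
   lists its terms with multiplicity, so that [size S] is its length. *)
Definition sequence_over (G : zmodType) (G0 : set G) (S : {mset G}%mset) : Prop :=
  forall g : G, g \in S -> G0 g.

Definition zero_sum (G : zmodType) (S : {mset G}%mset) : Prop :=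
  \sum_(g <- S) g = 0.

Definition minimal_zero_sum (G : zmodType) (S : {mset G}%mset) : Prop :=
  [/\ S <> mset0, zero_sum S &
      forall T : {mset G}%mset, (T `<` S)%mset -> T <> mset0 -> ~ zero_sum T].

(* The supremum is taken in N_0 together with infinity, where the supremum of
   the empty set is 0 (and not -oo, as it is in [\bar R]): hence the added 0. *)
Definition Davenport (R : realType) (G : zmodType) (G0 : set G) : \bar R :=
  ereal_sup ([set 0%E] `|`
    [set ((size S)%:R : R)%:E |
       S in [set S : {mset G}%mset | sequence_over G0 S /\ minimal_zero_sum S]]).

Definition std_basis (r : nat) (i : 'I_r) : 'rV[int]_r := delta_mx 0 i.

Definition Gplus (r : nat) : set 'rV[int]_r :=
  [set v | exists eps : 'I_r -> bool,
     (exists i, eps i) /\ v = \sum_(i < r) std_basis i *+ eps i].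

Definition Gpm (r : nat) : set 'rV[int]_r :=
  @Gplus r `|` [set - v | v in @Gplus r].

(* Main.v *)
Require Import Defs.
From mathcomp Require Import all_boot all_order all_algebra.
From mathcomp Require Import finmap multiset.
From mathcomp Require Import all_classical all_reals all_analysis.
From mathcomp Require Import ring lra zify.

(** Upper bound. A minimal zero-sum sequence over G_0 is either g(-g) or
    contains no antipodal pair. In the latter case its multiplicities form a
    vector u >= 0 in the left kernel of a matrix A whose rows are, up to
    sign, all the nonzero 0/1 vectors, so that this kernel has dimension d
    = 2^r - 1 - r. For every nonzero u >= 0 in the kernel there is a
    circuit supported on supp u: a vector of natural numbers which, by
    Cramer's rule, is a row of an adjugate matrix and whose length is the
    absolute value of one determinant of size at most r + 1. Bordering this
    determinant to a matrix with entries in {-1, 0, 1}, Hadamard's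
    inequality bounds it by b = (r+2)^((r+2)/2) / 2^r. Subtracting circuits
    greedily from u uses at most d of them, and all coefficients are below 1
    unless some circuit is <= u, in which case minimality makes u a circuit.
    Hence |u| <= d * b.

    Lower bound. F_k is the sum of the F_j with j < k and j - k odd, where
    the index 0 stands for one more term 1. This is a triangular linear
    system whose columns are, up to the signs (-1)^j, 0/1 vectors; its
    solutions are the multiples of (1, F_1, ..., F_r), whose entries add up
    to F_(r+2). *)

Set Implicit Arguments.
Unset Strict Implicit.
Unset Printing Implicit Defensive.

Import Order.TTheory GRing.Theory Num.Theory.
Local Open Scope ring_scope.

(** * Hadamard's inequality *)

Lemma row_sqnormE (F : comNzRingType) n (x : 'rV[F]_n) :
  (x *m x^T) 0 0 = \sum_j x 0 j ^+ 2.
Proof. by rewrite mxE; apply: eq_bigr => j _; rewrite mxE. Qed.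

Lemma row_sqnorm_ge0 (F : realFieldType) n (x : 'rV[F]_n) :
  0 <= (x *m x^T) 0 0.
Proof. by rewrite row_sqnormE sumr_ge0 // => j _; rewrite sqr_ge0. Qed.

Lemma row_sqnorm_eq0 (F : realFieldType) n (x : 'rV[F]_n) :
  x *m x^T = 0 -> x = 0.
Proof.
move=> /matrixP/(_ 0 0); rewrite row_sqnormE [RHS]mxE => /eqP.
rewrite psumr_eq0 => [/allP x0|j _]; last exact: sqr_ge0.
apply/rowP => j; rewrite mxE; apply/eqP.
by have := x0 j (mem_index_enum _); rewrite /= sqrf_eq0.
Qed.

(** Induction on the rows: removing from the first row its projection onto the others keeps the Gram
    determinant and does not lengthen the row. The lower bound 0 is carried along because the final
    products are compared factor by factor. *)
Lemma det_gram_bounds (F : realFieldType) n m (A : 'M[F]_(n, m)) :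
  0 <= \det (A *m A^T) <= \prod_i \sum_j A i j ^+ 2.
Proof.
elim: n A => [|n IHn] A; first by rewrite det_mx00 big_ord0 ler01 lexx.
move: (A : 'M[F]_(1 + n, m)) => {}A; rewrite -[A]vsubmxK.
set a := usubmx A; set B := dsubmx A; have /andP[G0 GB] := IHn B.
have prodE : \prod_i \sum_j col_mx a B i j ^+ 2
    = (a *m a^T) 0 0 * \prod_i \sum_j B i j ^+ 2.
  rewrite (@big_split_ord _ _ _ 1 n) big_ord1 /=; congr (_ * _).
    by rewrite row_sqnormE; apply: eq_bigr => j _; rewrite col_mxEu.
  by apply: eq_bigr => i _; apply: eq_bigr => j _; rewrite col_mxEd.
rewrite prodE; case: (eqVneq (\det (B *m B^T)) 0) => [dG|dG].
  (* A [v] in the kernel of the Gram matrix of [B] gives [v *m B] squared norm 0, so the rows of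
     [B], hence all rows, are dependent. *)
  have /eqP/det0P[v v0 vG] := dG.
  have vB : v *m B = 0.
    by apply: row_sqnorm_eq0; rewrite trmx_mul mulmxA -(mulmxA v) vG mul0mx.
  suff -> : \det (col_mx a B *m (col_mx a B)^T) = 0.
    rewrite lexx mulr_ge0 ?row_sqnorm_ge0 //; exact: le_trans GB.
  apply/eqP/det0P; exists (row_mx 0 v).
    apply: contraNneq v0 => /(congr1 rsubmx).
    by rewrite row_mxKr => ->; apply/eqP/rowP => j; rewrite !mxE.
  by rewrite mulmxA mul_row_col mul0mx add0r vB mul0mx.
(* Gram-Schmidt: [q] is the component of the first row [a] orthogonal to the
   rows of [B]. *)
have uG : B *m B^T \in unitmx by rewrite unitmxE unitfE.
pose P := a *m B^T *m invmx (B *m B^T); pose q := a - P *m B.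
have qB : q *m B^T = 0.
  by rewrite mulmxBl -(mulmxA P) mulmxKV // subrr.
have Bq : B *m q^T = 0 by rewrite -(trmxK B) -trmx_mul qB trmx0.
have aE : a = q + P *m B by rewrite subrK.
have colE : col_mx a B = block_mx 1%:M P 0 1%:M *m col_mx q B.
  by rewrite mul_block_col !mul1mx mul0mx add0r -aE.
have -> : \det (col_mx a B *m (col_mx a B)^T)
    = (q *m q^T) 0 0 * \det (B *m B^T).
  rewrite colE trmx_mul mulmxA -(mulmxA (block_mx _ _ _ _)) !det_mulmx det_tr.
  rewrite (@det_ublock _ 1 n) !det1 !mul1r mulr1 tr_col_mx mul_col_row qB Bq.
  by rewrite (@det_ublock _ 1 n) det_mx11.
have qa : (q *m q^T) 0 0 <= (a *m a^T) 0 0.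
  have qp : q *m (P *m B)^T = 0 by rewrite trmx_mul mulmxA qB mul0mx.
  have pq : (P *m B) *m q^T = 0 by rewrite -mulmxA Bq mulmx0.
  have aT : a^T = q^T + (P *m B)^T by rewrite -linearD -aE.
  have : (q + P *m B) *m (q^T + (P *m B)^T)
      = q *m q^T + (P *m B) *m (P *m B)^T.
    by rewrite mulmxDl !mulmxDr qp pq addr0 add0r.
  rewrite -aE -aT => ->; rewrite [leRHS]mxE lerDl.
  exact: row_sqnorm_ge0.
rewrite mulr_ge0 ?row_sqnorm_ge0 //=.
by rewrite ler_pM ?row_sqnorm_ge0.
Qed.

Lemma hadamard (F : realFieldType) n (A : 'M[F]_n) :
  (forall i j, A i j ^+ 2 <= 1) -> \det A ^+ 2 <= n%:R ^+ n.
Proof.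
move=> A1; have /andP[_] := det_gram_bounds A.
rewrite det_mulmx det_tr -expr2 => /le_trans; apply.
apply: (le_trans (y := \prod_(i < n) n%:R)); last first.
  by rewrite prodr_const card_ord.
apply: ler_prod => i _; rewrite sumr_ge0 => [|j _]; last exact: sqr_ge0.
apply: (le_trans (ler_sum _ (fun j _ => A1 i j))).
by rewrite sumr_const card_ord.
Qed.

(* Bordering [[1, V]] to the matrix [[1, 0, -1], [s, 1, 2 V - s]], whose entries
   lie in {-1, 0, 1}, multiplies the determinant by [2 ^ q]. *)
Lemma signed01_det_bound (F : realFieldType) q (V : 'M[F]_(q.+1, q))
    (s : 'cV[F]_q.+1) :
  (forall i, s i 0 ^+ 2 = 1) ->
  (forall i j, V i j = 0 \/ V i j = s i 0) ->
  \det (row_mx (const_mx 1) V : 'M[F]_(1 + q)) ^+ 2 * 4 ^+ q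
    <= q.+2%:R ^+ q.+2.
Proof.
move=> s1 Vs; set M := row_mx _ _.
pose r : 'rV[F]_(1 + q) := row_mx 0 (const_mx (-1)).
pose M2 : 'M[F]_(q.+1, 1 + q) := row_mx (const_mx 1) (2 *: V).
pose N : 'M[F]_(1 + (1 + q)) := block_mx 1%:M r s (s *m r + M2).
have detN : \det N = \det (M : 'M[F]_(1 + q)) * 2 ^+ q.
  have -> : N = block_mx 1%:M 0 s M2 *m block_mx 1%:M r 0 1%:M.
    by rewrite mulmx_block !mulmx1 !mul1mx !mul0mx mulmx0 !addr0.
  rewrite det_mulmx det_lblock det_ublock !det1 !mul1r mulr1.
  have -> : M2 = M *m block_mx 1%:M 0 0 2%:M.
    by rewrite mul_row_block !mulmx0 addr0 add0r mulmx1 mul_mx_scalar.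
  by rewrite det_mulmx det_ublock det1 det_scalar mul1r.
have -> : \det (M : 'M[F]_(1 + q)) ^+ 2 * 4 ^+ q = \det N ^+ 2.
  by rewrite detN exprMn -!exprM mulnC exprM; congr (_ * _ ^+ _); ring.
apply: hadamard => i j.
rewrite -(splitK i) -(splitK j).
case: (fintype.split i) => i'; case: (fintype.split j) => j' /=.
- by rewrite block_mxEul mxE !ord1 expr1n.
- rewrite block_mxEur -(splitK j'); case: (fintype.split j') => k /=.
    by rewrite row_mxEl mxE expr0n.
  by rewrite row_mxEr mxE sqrrN expr1n.
- by rewrite block_mxEdl !ord1 s1.
- rewrite block_mxEdr mxE mxE big_ord1.
  rewrite -(splitK j'); case: (fintype.split j') => k /=.
    by rewrite !row_mxEl !mxE mulr0 add0r expr1n.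
  (* The entry [2 V - s] is [- s] or [s], whose square is 1. *)
  rewrite !row_mxEr !mxE mulrN1; move: (s1 i').
  by case: (Vs i' k) => -> H; lra.
Qed.

(** * Small vectors in the kernel *)

(** The determinant bound for [q] columns is thus at most the one for [m]. By the first two binomial
    terms, (m+3)^(m+2) is at least 2 (m+2)^(m+2), so each step gains a factor 2 (m+3), which exceeds
    4. *)
Lemma pow_shift_mono q m : (q <= m)%N ->
  (q.+2 ^ q.+2 * 4 ^ (m - q) <= m.+2 ^ m.+2)%N.
Proof.
elim: m => [|m IHm]; first by rewrite leqn0 => /eqP ->.
rewrite leq_eqVlt => /predU1P[-> | qm]; first by rewrite subnn muln1.
rewrite subSn // (expnS 4) mulnCA.
apply: (leq_trans (leq_mul (leqnn 4) (IHm qm))).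
have bern : (2 * m.+2 ^ m.+2 <= m.+3 ^ m.+2)%N.
  rewrite -[m.+3]addn1 expnDn big_ord_recl big_ord_recl /= /bump /= addnA.
  rewrite subn0 subn1 bin0 bin1 !exp1n !mul1n !muln1 -expnS mul2n -addnn.
  by rewrite leq_addr.
rewrite (expnS m.+3); apply: leq_trans (leq_mul (leqnn m.+3) bern).
by rewrite mulnA leq_mul2r (_ : 4 <= _)%N ?orbT //; lia.
Qed.

(** As in the simplex method, [t] is the least quotient [u_i / z_i] with [z_i] positive: [u - t z]
    stays nonnegative and vanishes at [i0]. *)
Lemma ratio_test (F : realFieldType) n (u z : 'rV[F]_n) :
  (forall i, 0 <= u 0 i) -> (exists i, 0 < z 0 i) ->
  exists t i0, [/\ 0 <= t, 0 < z 0 i0, t * z 0 i0 = u 0 i0 &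
                   forall i, t * z 0 i <= u 0 i].
Proof.
move=> u0 [i1 zi1].
have [i0 zi0 mint] := @arg_minP _ F _ i1 (fun i => 0 < z 0 i)
  (fun i => u 0 i / z 0 i) zi1.
exists (u 0 i0 / z 0 i0), i0.
have t0 : 0 <= u 0 i0 / z 0 i0 by rewrite divr_ge0 // ltW.
split=> // [|i]; first by rewrite divfK // gt_eqF.
case: (ltrP 0 (z 0 i)) => zi; first by rewrite -ler_pdivlMr // mint.
by apply: le_trans (u0 i); rewrite mulr_ge0_le0.
Qed.

(** The appended diagonal block has a 1 exactly at the zeros of [u], so that the condition of being
    supported on supp [u] becomes linear and its solutions have a rank. *)
Definition suppker (F : fieldType) n m (A : 'M[F]_(n, m)) (u : 'rV[F]_n) :=
  kermx (row_mx A (diag_mx (\row_i (u 0 i == 0)%:R))).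

Lemma sub_suppkerP (F : fieldType) n m (A : 'M[F]_(n, m)) (u z : 'rV[F]_n) :
  reflect (z *m A = 0 /\ forall i, u 0 i = 0 -> z 0 i = 0)
          (z <= suppker A u)%MS.
Proof.
rewrite sub_kermx mul_mx_row; apply: (iffP eqP) => [zA|[-> zu]].
  split=> [|i ui].
    rewrite -[LHS](row_mxKl _ (z *m diag_mx (\row_i (u 0 i == 0)%:R))).
    by rewrite zA linear0.
  have /rowP/(_ i) : z *m diag_mx (\row_i (u 0 i == 0)%:R) = 0.
    by rewrite -[LHS](row_mxKr (z *m A)) zA linear0.
  by rewrite mul_mx_diag !mxE ui eqxx mulr1.
rewrite -[RHS]row_mx0; congr row_mx; apply/rowP => i.
by rewrite mul_mx_diag !mxE; case: eqP => [/zu ->|_]; rewrite ?mul0r ?mulr0.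
Qed.

Lemma colsub_rank_inj (F : fieldType) k m (B : 'M[F]_(k, m)) :
  exists r (g : 'I_r -> 'I_m), r = \rank B /\
    forall z : 'rV_k, z *m mxsub id g B = 0 -> z *m B = 0.
Proof.
exists (\rank B^T), (maxrankfun B^T); split=> [|z zg]; first exact: mxrank_tr.
have /submxP[X BX] : (B^T <= mxsub (maxrankfun B^T) id B^T)%MS.
  by rewrite eq_maxrowsub.
by rewrite -(trmxK B) BX trmx_mul mulmxA trmx_mxsub trmxK zg mul0mx.
Qed.

(** Multiplication by [mxsub f id 1%:M] extends a vector by zero outside the image of [f]. *)
Lemma supp_extend (F : fieldType) n k (f : 'I_k -> 'I_n) (u : 'rV[F]_n) :
  injective f -> (forall i, u 0 i != 0 -> exists j, i = f j) ->
  u = mxsub id f u *m mxsub f id 1%:M.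
Proof.
move=> fI fu; apply/rowP => i; rewrite mxE.
have [ui|ui] := eqVneq (u 0 i) 0.
  rewrite big1 ?ui // => j _; rewrite !mxE.
  by case: eqP => [->|_]; rewrite ?ui ?mul0r ?mulr0.
have [j ->] := fu i ui; rewrite (bigD1 j) //= !mxE eqxx mulr1 big1 ?addr0 //.
by move=> l lj; rewrite !mxE (inj_eq fI) (negPf lj) mulr0.
Qed.

(* When the kernel vectors supported on [supp u] form a line, the rows of [A] in
   [supp u] have corank one, and deleting columns leaves a [(q + 1) x q] matrix
   with the same left kernel. *)
Lemma circuit_submatrix (F : fieldType) n m (A : 'M[F]_(n, m)) (u : 'rV[F]_n) :
  u != 0 -> u *m A = 0 -> (\rank (suppker A u) <= 1)%N ->
  exists q (f : 'I_q.+1 -> 'I_n) (g : 'I_q -> 'I_m),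
    [/\ (q <= m)%N, injective f, forall i, u 0 i != 0 <-> exists j, i = f j,
        mxsub id f u *m mxsub f g A = 0
      & forall z : 'rV_q.+1, z *m mxsub f g A = 0 ->
          exists t, z = t *: mxsub id f u].
Proof.
move=> u0 uA rk1.
have kerE (z : 'rV_n) : z *m A = 0 -> (forall i, u 0 i = 0 -> z 0 i = 0) ->
    exists t, z = t *: u.
  move=> zA zu; apply/sub_rVP.
  have uK : (u <= suppker A u)%MS by apply/sub_suppkerP.
  apply: submx_trans (_ : suppker A u <= u)%MS; first exact/sub_suppkerP.
  by rewrite -(geq_leqif (mxrank_leqif_sup uK)) rank_rV u0.
pose J := [set i | u 0 i != 0]%SET.
have [k [f [fI fJ]]] : exists k (f : 'I_k -> 'I_n),
    injective f /\ forall i, u 0 i != 0 <-> exists j, i = f j.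
  exists #|J|, enum_val; split=> [|i]; first exact: enum_val_inj.
  split=> [ui|[j ->]]; last by have := enum_valP j; rewrite inE.
  have iJ : i \in J by rewrite inE.
  by exists (enum_rank_in iJ i); rewrite enum_rankK_in.
have fu i : u 0 i != 0 -> exists j, i = f j by case: (fJ i) => + _.
set w := mxsub id f u; set B := mxsub f id A.
have wB : w *m B = 0 by rewrite /B rowsubE mulmxA -supp_extend.
have w0 : w != 0.
  by apply: contraNneq u0 => w0; rewrite (supp_extend fI fu) -/w w0 mul0mx.
have kerB (z : 'rV_k) : z *m B = 0 -> exists t, z = t *: w.
  move=> zB; pose z' := z *m mxsub f id 1%:M.
  have z'E j : z' 0 (f j) = z 0 j.
    rewrite mxE (bigD1 j) //= !mxE eqxx mulr1 big1 ?addr0 // => l lj.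
    by rewrite !mxE (inj_eq fI) (negPf lj) mulr0.
  have [||t z't] := kerE z'.
  - by rewrite -mulmxA -rowsubE.
  - move=> i ui; rewrite mxE big1 // => j _; rewrite !mxE.
    case: eqP => [fj|_]; last by rewrite mulr0.
    have := (fJ i).2 (ex_intro _ j (esym fj)).
    by rewrite ui eqxx.
  exists t; apply/rowP => j; rewrite -z'E z't !mxE //.
(* The left kernel of [B] is the line through [w]. *)
have rkB : k = (\rank B).+1.
  have : \rank (kermx B) = 1%N.
    apply/eqP; rewrite eqn_leq; apply/andP; split.
      rewrite (leq_trans _ (rank_leq_row w)) // mxrankS //; apply/row_subP => i.
      by apply/sub_rVP/kerB/eqP; rewrite -sub_kermx row_sub.
    have <- : \rank w = 1%N by rewrite rank_rV w0.
    by rewrite mxrankS // sub_kermx wB.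
  by rewrite mxrank_ker => e; have := rank_leq_row B; lia.
have [q [g [qE gB]]] := colsub_rank_inj B.
have BE : mxsub id g B = mxsub f g A by rewrite -mxsub_comp.
case: k => [|k] in f fI fJ fu w B wB w0 kerB rkB g qE gB BE *.
  by case: (rkB).
have {}qE : q = k by case: rkB => ->.
subst q; exists k, f, g; split=> //.
- by rewrite -ltnS rkB ltnS rank_leq_col.
- by rewrite -BE mulmx_colsub wB; apply/matrixP => i j; rewrite !mxE.
- by move=> z; rewrite -BE => /gB/kerB.
Qed.

(** Let [w] be [u] on its support, [S] its sum and [M] the square matrix [[1, V]]. Then
    [w M = (S, 0, ..., 0)], and multiplying by the adjugate shows that row 0 of [\adj M] is
    [det M / S] times [w]. Its absolute values are the numbers [c]; they add up to [|det M|]. *)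
Lemma cramer_kernel (F : realFieldType) n m (A : 'M[int]_(n, m))
    (s : 'I_n -> int) (u : 'rV[F]_n) :
  (forall i, s i ^+ 2 = 1) -> (forall i j, A i j = 0 \/ A i j = s i) ->
  (forall i, 0 <= u 0 i) -> u != 0 -> u *m map_mx intr A = 0 ->
  (\rank (suppker (map_mx intr A) u) <= 1)%N ->
  exists (t : F) (c : 'I_n -> nat),
    [/\ 0 < t, forall i, (c i)%:R = t * u 0 i &
        ((\sum_i c i) ^ 2 * 4 ^ m <= m.+2 ^ m.+2)%N].
Proof.
move=> s1 As u0 un0 uA rk1.
have [q [f [g [qm fI fJ wV kerV]]]] := circuit_submatrix un0 uA rk1.
set w := mxsub id f u in wV kerV.
pose V := mxsub f g A; pose M : 'M[int]_(1 + q) := row_mx (const_mx 1) V.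
have VE : mxsub f g (map_mx intr A) = map_mx intr V :> 'M[F]_(q.+1, q).
  by rewrite map_mxsub.
rewrite {}VE in wV kerV.
have ME : map_mx intr M = row_mx (const_mx 1) (map_mx intr V) :> 'M[F]_(1 + q).
  by rewrite map_row_mx map_const_mx rmorph1.
have wu k : w 0 k = u 0 (f k) by rewrite mxE.
have w_gt0 k : 0 < w 0 k.
  by rewrite wu lt_def u0 andbT; apply/(fJ _).2; exists k.
pose S := \sum_k w 0 k.
have SE : S = \sum_i u 0 i.
  rewrite (supp_extend fI (fun i => (fJ i).1)).
  under [RHS]eq_bigr do rewrite mxE.
  rewrite exchange_big; apply: eq_bigr => j _; rewrite (bigD1 (f j)) //= !mxE.
  rewrite eqxx mulr1 big1 ?addr0 // => i ij; rewrite !mxE.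
  by rewrite eq_sym (negPf ij) mulr0.
have S_gt0 : 0 < S.
  rewrite /S (bigD1 ord0) //= ltr_pwDl // sumr_ge0 // => i _; exact: ltW.
have wM (z : 'rV[F]_(1 + q)) :
    z *m map_mx intr M = row_mx (\sum_k z 0 k)%:M (z *m map_mx intr V).
  rewrite ME mul_mx_row; congr row_mx; apply/rowP => k.
  by rewrite !mxE !ord1 eqxx mulr1n; apply: eq_bigr => l _; rewrite mxE mulr1.
set d := \det M.
(* A vector killed by [M] would be a multiple of [w] with entry sum 0, but [w] has positive sum. *)
have d0 : d%:~R != 0 :> F.
  rewrite -det_map_mx; apply/det0P => -[v v0]; rewrite wM => vM.
  have vV : v *m map_mx intr V = 0.
    by rewrite -[LHS](row_mxKr (\sum_k v 0 k)%:M) vM linear0.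
  have vS : \sum_k v 0 k = 0.
    have := row_mxKl (\sum_k v 0 k)%:M (v *m map_mx intr V).
    by rewrite vM linear0 => /rowP/(_ 0); rewrite !mxE eqxx mulr1n.
  have [t vt] := kerV v vV; move: v0; rewrite vt.
  move: vS; rewrite vt.
  under eq_bigr do rewrite mxE.
  rewrite -mulr_sumr -/S => /eqP; rewrite mulf_eq0 (gt_eqF S_gt0) orbF.
  move=> /eqP ->.
  by rewrite scale0r eqxx.
have adjE k : (\adj M 0 k)%:~R * S = d%:~R * w 0 k.
  have := congr1 (mulmx w) (mul_mx_adj (map_mx intr M)).
  rewrite mulmxA wM wV mul_mx_scalar det_map_mx -/d => /rowP/(_ k).
  rewrite [RHS]mxE => <-.
  rewrite [RHS]mxE (@big_split_ord _ _ _ 1 q) big_ord1 /= row_mxEl.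
  rewrite [X in _ = X * _ + _]mxE eqxx mulr1n [X in _ + X]big1 ?addr0.
    rewrite mulrC -map_mx_adj [in RHS]mxE -/S.
    by congr (_ * (\adj M _ k)%:~R); exact: val_inj.
  by move=> i _; rewrite row_mxEr mxE mul0r.
have cE (i : 'I_n) : exists c : nat, c%:R = `|d%:~R| / S * u 0 i :> F.
  have [ui|ui] := eqVneq (u 0 i) 0; first by exists 0%N; rewrite ui mulr0.
  have [k ->] := (fJ i).1 ui; exists (absz (\adj M 0 k)).
  rewrite -wu mulrAC -{1}(gtr0_norm (w_gt0 k)) -normrM -adjE normrM.
  by rewrite (gtr0_norm S_gt0) mulfK ?gt_eqF // -intr_norm natr_absz.
have [c cP] := fin_all_exists cE.
exists (`|d%:~R| / S), c; split=> //; first by rewrite divr_gt0 // normr_gt0.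
have sumc : (\sum_i c i)%:R = `|d%:~R| :> F.
  rewrite natr_sum (eq_bigr _ (fun i _ => cP i)) -mulr_sumr -SE divfK //.
  by rewrite gt_eqF.
apply: leq_trans (pow_shift_mono qm).
rewrite -{1}(subnKC qm) expnD mulnA leq_mul2r.
apply/orP; right; rewrite -(ler_nat F) natrM !natrX sumc.
rewrite real_normK ?num_real // -det_map_mx ME.
apply: signed01_det_bound (\col_k (s (f k))%:~R) _ _ => [i|i j].
  by rewrite mxE -rmorphXn s1.
by rewrite !mxE; case: (As (f i) (g j)) => ->; [left|right].
Qed.

(** Induction on the support of [u]: while the kernel vectors on it do not form a line, moving [u]
    along one not proportional to it kills a coordinate. *)
Lemma bounded_kernel_vector (F : realFieldType) n m (A : 'M[int]_(n, m))
    (s : 'I_n -> int) (u : 'rV[F]_n) :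
  (forall i, s i ^+ 2 = 1) -> (forall i j, A i j = 0 \/ A i j = s i) ->
  (forall i, 0 <= u 0 i) -> u != 0 -> u *m map_mx intr A = 0 ->
  exists c : 'I_n -> nat,
    [/\ exists i, c i != 0%N, (\row_i (c i)%:R : 'rV[F]_n) *m map_mx intr A = 0,
        forall i, u 0 i = 0 -> c i = 0%N &
        ((\sum_i c i) ^ 2 * 4 ^ m <= m.+2 ^ m.+2)%N].
Proof.
move=> s1 As.
have [N leN] := ubnP #|[set i | u 0 i != 0]%SET|.
elim: N => // N IHN in u leN *; move=> u0 un0 uA.
case: (leqP (\rank (suppker (map_mx intr A) u)) 1) => rk.
  have [t [c [t0 cE cb]]] := cramer_kernel s1 As u0 un0 uA rk.
  exists c; split=> //.
  - have [i ui] := rV0Pn _ un0; exists i; rewrite -(pnatr_eq0 F) cE.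
    by rewrite mulf_neq0 // gt_eqF.
  - have -> : \row_i (c i)%:R = t *: u by apply/rowP => i; rewrite !mxE.
    by rewrite -scalemxAl uA scaler0.
  - by move=> i ui; apply/eqP; rewrite -(pnatr_eq0 F) cE ui mulr0.
have [z [zK zu]] : exists z : 'rV_n,
    (z <= suppker (map_mx intr A) u)%MS /\ ~~ (z <= u)%MS.
  have /row_subPn[i ni] : ~~ (suppker (map_mx intr A) u <= u)%MS.
    apply: contraL rk => /mxrankS; rewrite -leqNgt => /leq_trans; apply.
    exact: rank_leq_row.
  by exists (row i (suppker (map_mx intr A) u)); rewrite row_sub.
wlog zp : z zK zu / exists i, 0 < z 0 i.
  move=> H; have [i zi] : exists i, z 0 i != 0.
    by apply/rV0Pn; apply: contraNneq zu => ->; rewrite sub0mx.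
  case: (ltrgt0P (z 0 i)) zi => // zi _.
    by apply: (H z) => //; exists i.
  by apply: (H (- z)); rewrite ?eqmx_opp //; exists i; rewrite mxE oppr_gt0.
have /sub_suppkerP[zA zsupp] := zK.
have [t [i0 [t0 zi0 ti0 tz]]] := ratio_test u0 zp.
pose v := u - t *: z.
have vE i : v 0 i = u 0 i - t * z 0 i by rewrite !mxE.
have uv i : u 0 i = 0 -> v 0 i = 0.
  by move=> ui; rewrite vE ui zsupp // mulr0 subrr.
have [||||c [c0 cA cv cb]] := IHN v.
- apply: (leq_trans (n := #|[set i | u 0 i != 0]%SET|)); last by rewrite -ltnS.
  apply/proper_card/properP; split.
    by apply/fintype.subsetP => i; rewrite !inE; apply: contraNneq => /uv ->.
  exists i0; rewrite !inE; last by rewrite negbK vE ti0 subrr.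
  by apply: contraTneq zi0 => /zsupp ->; rewrite ltxx.
- by move=> i; rewrite vE subr_ge0.
(* If [v] vanished, [z] would be a multiple of [u]. *)
- apply: contraNneq zu => /eqP; rewrite subr_eq0 => /eqP utz.
  have tn0 : t != 0 by apply: contraNneq un0 => t00; rewrite utz t00 scale0r.
  by apply/sub_rVP; exists t^-1; rewrite utz scalerA mulVf // scale1r.
- by rewrite mulmxBl uA -scalemxAl zA scaler0 subr0.
by exists c; split=> // i /uv /cv.
Qed.

(** * Greedy decomposition of nonnegative kernel vectors *)

Definition short_kernel_vector (F : realFieldType) n m (A : 'M[F]_(n, m))
    (b : F) (c : 'I_n -> nat) : Prop :=
  [/\ exists i, c i != 0%N, (\row_i (c i)%:R : 'rV[F]_n) *m A = 0
    & (\sum_i c i)%:R <= b].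

(* The kernel vectors supported on [supp u] form a space whose dimension drops
   each time a small vector [c] is subtracted with the largest admissible
   coefficient, which is less than 1 unless [c <= u]. *)
Lemma greedy_sum_bound (F : realFieldType) n m (A : 'M[F]_(n, m)) (b : F) :
  0 <= b ->
  (forall u : 'rV[F]_n, (forall i, 0 <= u 0 i) -> u != 0 -> u *m A = 0 ->
     exists2 c, short_kernel_vector A b c & forall i, u 0 i = 0 -> c i = 0%N) ->
  forall u : 'rV[F]_n, (forall i, 0 <= u 0 i) -> u *m A = 0 ->
    (exists2 c, short_kernel_vector A b c & forall i, (c i)%:R <= u 0 i)
    \/ \sum_i u 0 i <= (n - \rank A)%:R * b.
Proof.
move=> b0 small u u0 uA.
suff : (exists2 c, short_kernel_vector A b c & forall i, (c i)%:R <= u 0 i)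
    \/ \sum_i u 0 i <= (\rank (suppker A u))%:R * b.
  case=> [|ub]; [by left|right; apply: le_trans ub _].
  rewrite ler_wpM2r // ler_nat -mxrank_ker mxrankS //.
  by apply/row_subP => i; rewrite sub_kermx;
    have /sub_suppkerP[-> _] := row_sub i (suppker A u).
have [N leN] := ubnP (\rank (suppker A u)).
elim: N => // N IHN in u leN u0 uA *.
have [->|un0] := eqVneq u 0.
  by right; rewrite big1 ?mulr_ge0 // => i _; rewrite mxE.
have [c [[i1 c1] cA cb] cu] := small u u0 un0 uA.
pose z : 'rV[F]_n := \row_i (c i)%:R.
have zE i : z 0 i = (c i)%:R by rewrite mxE.
have [|t [i0 [t0 zi0 ti0 tz]]] := @ratio_test _ _ u z u0.
  by exists i1; rewrite zE ltr0n lt0n.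
case: (lerP 1 t) => t1.
  left; exists c; first by split=> //; exists i1.
  by move=> i; apply: le_trans (tz i); rewrite -zE ler_peMl // zE ler0n.
pose v := u - t *: z.
have vE i : v 0 i = u 0 i - t * z 0 i by rewrite !mxE.
have v0 i : 0 <= v 0 i by rewrite vE subr_ge0.
have vA : v *m A = 0 by rewrite mulmxBl uA -scalemxAl cA scaler0 subr0.
have ui0 : u 0 i0 != 0.
  by apply: contraTneq zi0 => /cu; rewrite zE => ->; rewrite ltxx.
(* The inclusion is strict because [u] itself is lost: [v] vanishes at [i0] and [u] does not. *)
have rkv : (\rank (suppker A v) < \rank (suppker A u))%N.
  apply/rank_ltmx; rewrite ltmxE; apply/andP; split.
    apply/row_subP => i; apply/sub_suppkerP.
    have /sub_suppkerP[-> vs] := row_sub i (suppker A v).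
    by split=> // j uj; apply: vs; rewrite vE uj zE cu // mulr0 subrr.
  apply/negP => /(submx_trans (_ : u <= suppker A u)%MS) uv.
  have /uv/sub_suppkerP[_ /(_ i0)] : (u <= suppker A u)%MS.
    by apply/sub_suppkerP.
  by rewrite vE ti0 subrr => /(_ erefl)/eqP; rewrite (negPf ui0).
case: (IHN v _ v0 vA) => [|[c' c'P c'v]|vb].
- by rewrite (leq_trans rkv).
- left; exists c' => // i; apply: le_trans (c'v i) _.
  by rewrite vE gerBl mulr_ge0 // zE ler0n.
right; have -> : \sum_i u 0 i = \sum_i v 0 i + t * (\sum_i c i)%:R.
  rewrite natr_sum mulr_sumr -big_split; apply: eq_bigr => i _ /=.
  by rewrite vE zE subrK.
apply: (le_trans (y := (\rank (suppker A v)).+1%:R * b)); last first.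
  by rewrite ler_wpM2r // ler_nat.
rewrite -natr1 mulrDl mul1r lerD // (le_trans _ cb) // ler_piMl //.
exact: ltW.
Qed.

(** * Minimal zero-sum sequences over an injective family *)

Lemma sum_mset_family (G : choiceType) (I : finType) (w : I -> G)
    (S : {mset G}%mset) (V : nmodType) (f : G -> V) :
  injective w -> (forall g, g \in S -> exists i, g = w i) ->
  \sum_(g <- S) f g = \sum_i f (w i) *+ S (w i).
Proof.
move=> wI Sw.
have -> : \sum_(g <- S) f g = \sum_(g <- S) \sum_(i | w i == g) f (w i).
  apply: eq_big_seq => g /Sw[i ->].
  by rewrite (big_pred1 i) // => j; rewrite (inj_eq wI).
rewrite (exchange_big_dep predT) //=; apply: eq_bigr => i _.
rewrite big_const_seq iter_addr addr0 -count_mem_mset; congr (_ *+ _).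
by apply: eq_count => g /=; rewrite eq_sym.
Qed.

Lemma size_mset_family (G : choiceType) (I : finType) (w : I -> G)
    (S : {mset G}%mset) :
  injective w -> (forall g, g \in S -> exists i, g = w i) ->
  size S = (\sum_i S (w i))%N.
Proof.
move=> wI Sw; apply/eqP; rewrite -(eqr_nat int) -sum1_size !natr_sum.
by rewrite (sum_mset_family _ wI Sw).
Qed.

Definition mset_family (G : choiceType) (I : finType) (w : I -> G)
    (c : I -> nat) : {mset G}%mset :=
  seq_mset (flatten [seq nseq (c i) (w i) | i <- enum I]).

Lemma mset_familyE (G : choiceType) (I : finType) (w : I -> G)
    (c : I -> nat) i :
  injective w -> mset_family w c (w i) = c i.
Proof.
move=> wI; rewrite mset_seqE count_flatten -map_comp sumnE big_map big_enum /=.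
rewrite (bigD1 i) //= count_nseq /= eqxx mul1n big1 ?addn0 // => j ji.
by rewrite count_nseq /= (inj_eq wI) (negPf ji).
Qed.

Lemma mem_mset_family (G : choiceType) (I : finType) (w : I -> G) (c : I -> nat)
    g : g \in mset_family w c -> exists i, g = w i.
Proof.
rewrite -mset_neq0 mset_seqE -lt0n -has_count has_pred1 => /flatten_mapP[i _].
by rewrite mem_nseq => /andP[_ /eqP ->]; exists i.
Qed.

(** The multiplicities [c] define a nonempty zero-sum subsequence of [S], which by minimality is all
    of [S]. *)
Lemma minimal_family (G : zmodType) (I : finType) (w : I -> G)
    (S : {mset G}%mset) (c : I -> nat) :
  injective w -> (forall g, g \in S -> exists i, g = w i) ->
  minimal_zero_sum S -> (forall i, (c i <= S (w i))%N) ->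
  (exists i, c i != 0%N) ->
  \sum_i w i *+ c i = 0 -> forall i, c i = S (w i).
Proof.
move=> wI Sw [_ _ Smin] cS [i0 ci0] c0.
have TS : (mset_family w c `<=` S)%mset.
  apply/msubsetP => g; case: (boolP (g \in mset_family w c)) => [gT|].
    by have [i ->] := mem_mset_family gT; rewrite mset_familyE.
  by move=> /mset_eq0P ->.
case: (eqVmproper TS) => [<- i|TSp]; first by rewrite mset_familyE.
case: (Smin _ TSp).
  move=> /(congr1 (fun T : {mset G}%mset => T (w i0))) /eqP.
  by rewrite mset_familyE // mset0E (negPf ci0).
rewrite /zero_sum (sum_mset_family id wI (@mem_mset_family _ _ w c)) -[RHS]c0.
by apply: eq_bigr => i _; rewrite mset_familyE.
Qed.

(** * The Davenport constant and the elements of G_0 *)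

Lemma Davenport_ge (R : realType) (G : zmodType) (G0 : set G)
    (S : {mset G}%mset) :
  sequence_over G0 S -> minimal_zero_sum S ->
  ((size S)%:R%:E <= Davenport R G0)%E.
Proof. by move=> SG Smin; apply: ereal_sup_ubound; right; exists S. Qed.

(** The condition [0 <= b] accounts for the 0 adjoined to the set of lengths. *)
Lemma Davenport_le (R : realType) (G : zmodType) (G0 : set G) (b : R) :
  0 <= b ->
  (forall S : {mset G}%mset, sequence_over G0 S -> minimal_zero_sum S ->
     (size S)%:R <= b) ->
  (Davenport R G0 <= b%:E)%E.
Proof.
move=> b0 Sb; apply: ge_ereal_sup => _ [->|[S [SG Smin] <-]].
  by rewrite lee_fin.
by rewrite lee_fin Sb.
Qed.

Lemma GpmP r (g : 'rV[int]_r) :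
  Gpm g <-> exists eps : 'I_r -> bool, (exists i, eps i) /\
    (g = \row_k (eps k)%:R \/ g = - \row_k (eps k)%:R).
Proof.
have sumE (eps : 'I_r -> bool) :
    \sum_(i < r) @std_basis r i *+ eps i = \row_k (eps k)%:R.
  apply/rowP => k; rewrite summxE mxE (bigD1 k) //= big1 ?addr0 => [|i ik].
    by rewrite mulmxnE mxE !eqxx.
  by rewrite mulmxnE mxE eqxx eq_sym (negPf ik) mul0rn.
split=> [[[eps [e0 ->]]|[_ [eps [e0 ->]] <-]]|[eps [e0 [->|->]]]].
- by exists eps; split=> //; left.
- by exists eps; split=> //; right; rewrite sumE.
- by left; exists eps; rewrite sumE.
- by right; exists (\row_k (eps k)%:R) => //; exists eps; rewrite sumE.
Qed.

(** * The lower bound *)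

(** The value at index 0 is the additional term 1, in place of F_0 = 0. *)
Definition fib1 (j : nat) : nat := if j is 0 then 1%N else fib j.

(** Induction in steps of two: raising the index by 2 keeps the parity condition and adds just the
    term before the new index, which is the Fibonacci recursion. *)
Lemma fib1_rec k :
  fib1 k.+1 = (\sum_(j < k.+1 | odd (k.+1 + j)) fib1 j)%N.
Proof.
elim/ltn_ind: k => -[|[|k]] IH.
- by rewrite big_mkcond big_ord1.
- by rewrite big_mkcond big_ord_recl big_ord1.
rewrite -(big_mkord (fun j => odd (k.+3 + j)) fib1) big_mkcond.
rewrite big_nat_recr // big_nat_recr // -big_mkcond big_mkord.
have -> : odd (k.+3 + k.+1) = false by lia.
have -> : odd (k.+3 + k.+2) by lia.
rewrite (eq_bigl (fun i : 'I_k.+1 => odd (k.+1 + i))) => [|i]; last by lia.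
by rewrite -IH // -[RHS]/(fib1 k.+1 + 0 + fib1 k.+2)%N addn0 addnC.
Qed.

Lemma sum_fib1 r : (\sum_(j < r.+1) fib1 j = fib r.+2)%N.
Proof.
elim: r => [|r IHr]; first by rewrite big_ord1.
by rewrite big_ord_recr IHr /= addnC.
Qed.

(* [sum_j x_j g_j = 0] is the triangular system
   [x_k = sum_(j < k, j <> k mod 2) x_j], k = 1..r, whose solution is
   [x_0 * (1, F_1, ..., F_r)]. *)
Definition fib_vec (r : nat) (j : 'I_r.+1) : 'rV[int]_r :=
  \row_(k < r) ((-1) ^+ j *
    ((j == k.+1 :> nat) || (j < k.+1)%N && odd (k.+1 + j))%:R).

Lemma fib_vec_sumE r (y : nat -> nat) (k : 'I_r) :
  (\sum_(j < r.+1) fib_vec j *+ y j) 0 k =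
  (-1) ^+ k.+1 * ((y k.+1)%:R - (\sum_(j < k.+1 | odd (k.+1 + j)) y j)%:R).
Proof.
rewrite summxE.
pose a j : int :=
  (-1) ^+ j * ((j == k.+1) || (j < k.+1)%N && odd (k.+1 + j))%:R *+ y j.
rewrite (eq_bigr (fun j : 'I_r.+1 => a j)); last first.
  by move=> j _; rewrite mulmxnE mxE.
rewrite -(big_mkord predT a) (@big_cat_nat _ _ _ k.+2) //=; last exact: ltn_ord.
rewrite [X in _ + X]big_nat_cond [X in _ + X]big1 ?addr0; last first.
  move=> j /andP[/andP[kj _] _]; rewrite /a.
  rewrite (_ : j == k.+1 = false); last by lia.
  by rewrite (_ : (j < k.+1)%N = false) ?mulr0 ?mul0rn //; lia.
rewrite big_nat_recr //= {2}/a eqxx mulr1 mulrBr addrC; congr (_ + _).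
  by rewrite mulr_natr.
rewrite big_mkord natr_sum mulr_sumr -sumrN [RHS]big_mkcond.
apply: eq_bigr => j _; rewrite /a ltn_eqF // ltn_ord /=.
case: ifP => kj; last by rewrite mulr0 mul0rn.
rewrite mulr1 -mulr_natr -mulNr; congr (_ * _).
(* Only indices [j] of parity opposite to [k.+1] remain, whence the opposite sign. *)
rewrite -signr_odd -[in RHS]signr_odd (_ : odd k.+1 = ~~ odd j); last by lia.
by case: (odd j); rewrite ?opprK.
Qed.

Lemma fib_vec_kernel r (y : nat -> nat) :
  \sum_(j < r.+1) fib_vec j *+ y j = 0 <->
  forall k, (k <= r)%N -> y k = (y 0 * fib1 k)%N.
Proof.
split=> [y0|ye].
  elim/ltn_ind => -[|k] IH kr; first by rewrite muln1.
  have /rowP/(_ (Ordinal kr)) := y0.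
  rewrite fib_vec_sumE [RHS]mxE => /eqP; rewrite mulf_eq0 signr_eq0 orFb.
  rewrite subr_eq0 eqr_nat => /eqP ->.
  rewrite fib1_rec big_distrr; apply: eq_bigr => j _.
  by apply: IH => //; rewrite (leq_trans _ kr) // ltnW.
apply/rowP => k; rewrite fib_vec_sumE [RHS]mxE ye //.
rewrite fib1_rec big_distrr.
rewrite (eq_bigr (fun j : 'I_k.+1 => y j)) ?subrr ?mulr0 // => j _ /=.
by rewrite -ye // (leq_trans (ltnW (ltn_ord j))).
Qed.

(** For [i < j] the two vectors differ in the coordinate of equation [j]: there the later one is
    [(-1)^j], the earlier one 0 or of opposite sign. *)
Lemma fib_vec_inj r : injective (@fib_vec r).
Proof.
have lt_neq (i j : 'I_r.+1) : (i < j)%N -> fib_vec i != fib_vec j.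
  case: j => -[//|j] jr /= ij; apply/eqP.
  move=> /rowP/(_ (Ordinal (jr : (j < r)%N))).
  rewrite !mxE /= eqxx mulr1 ltn_eqF // ij /= -signr_odd -[RHS]signr_odd.
  rewrite /= oddD; case: (odd i); case: (odd j) => //=.
move=> i j ij; apply/val_inj; case: (ltngtP i j) => //= /lt_neq.
  by rewrite ij eqxx.
by rewrite ij eqxx.
Qed.

Lemma Gpm_fib_vec r (j : 'I_r.+1) : (0 < r)%N -> Gpm (fib_vec j).
Proof.
move=> r0; apply/GpmP.
exists (fun k : 'I_r => (j == k.+1 :> nat) || (j < k.+1)%N && odd (k.+1 + j)).
split.
  case: j => -[|j] jr /=; first by exists (Ordinal r0).
  by exists (Ordinal (jr : (j < r)%N)); rewrite eqxx.
case: (boolP (odd j)) => oj; [right|left]; apply/rowP => k; rewrite !mxE.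
  by rewrite -signr_odd oj mulN1r.
by rewrite -signr_odd (negPf oj) mul1r.
Qed.

Lemma Davenport_Gpm_ge_fib (R : realType) r : (0 < r)%N ->
  (((fib (r + 2))%:R : R)%:E <= Davenport R (@Gpm r))%E.
Proof.
move=> r0; pose c (j : 'I_r.+1) := fib1 j.
pose S := mset_family (@fib_vec r) c.
have wI := @fib_vec_inj r.
have SE j : S (fib_vec j) = fib1 j by rewrite mset_familyE.
have Sw g : g \in S -> exists j, g = fib_vec j by apply: mem_mset_family.
pose y (T : {mset 'rV[int]_r}%mset) k := T (fib_vec (inord k : 'I_r.+1)).
have sumE (T : {mset 'rV[int]_r}%mset) :
    (forall g, g \in T -> exists j, g = fib_vec j) -> zero_sum T <->
    \sum_(j < r.+1) fib_vec j *+ y T j = 0.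
  move=> Tw; rewrite /zero_sum (sum_mset_family id wI Tw).
  by under [in X in _ <-> X]eq_bigr do rewrite /y inord_val.
have <- : size S = fib (r + 2).
  rewrite (size_mset_family wI Sw) addn2 -sum_fib1.
  by apply: eq_bigr => j _; rewrite SE.
apply: Davenport_ge => [g /Sw[j ->]|]; first exact: Gpm_fib_vec.
have SEn k : (k <= r)%N -> y S k = fib1 k.
  by move=> kr; rewrite /y SE inordK.
split.
- move=> /(congr1 (fun T : {mset _}%mset => T (fib_vec (ord0 : 'I_r.+1)))).
  by rewrite SE mset0E.
- apply/sumE => //; apply/(fib_vec_kernel r (y S)) => k kr.
  by rewrite !SEn // mul1n.
move=> T /andP[/msubsetP TS /msubsetP TS'] T0.
have Tw g : g \in T -> exists j, g = fib_vec j.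
  move=> gT; apply: Sw; rewrite -mset_gt0 (leq_trans _ (TS g)) //.
  by rewrite mset_gt0.
move=> /(sumE T Tw)/(fib_vec_kernel r (y T)) TE.
(* [fib_vec 0] occurs once in [S]. Its multiplicity in [T] determines all others, so 1 forces
   [T = S] and 0 forces [T] to be empty. *)
have := TS (fib_vec (inord 0 : 'I_r.+1)); rewrite -/(y T 0) -/(y S 0) SEn //=.
rewrite leq_eqVlt ltnS leqn0 => /orP[/eqP e1|/eqP e0].
  apply: TS' => g; case: (boolP (g \in S)) => [/Sw[j ->]|/mset_eq0P ->] //.
  by have := TE j (ltnSE (ltn_ord j)); rewrite e1 mul1n /y inord_val SE => ->.
apply: T0; apply/msetP => g; rewrite mset0E; apply/mset_eq0P/negP => gT.
have [j gj] := Tw g gT; move: gT; rewrite -mset_neq0 gj.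
by have := TE j (ltnSE (ltn_ord j)); rewrite e0 mul0n /y inord_val => ->.
Qed.

(** * The upper bound *)

(** The sequence g(-g) is a zero-sum subsequence of [S], hence equal to [S]. *)
Lemma antipodal_minimal_size (G : zmodType) (S : {mset G}%mset) (g : G) :
  minimal_zero_sum S -> g != - g -> g \in S -> - g \in S -> size S = 2%N.
Proof.
move=> Smin gN gS gNS; pose w (b : bool) := if b then g else - g.
have wI : injective w.
  by move=> [] [] //= /eqP; rewrite ?(negPf gN) // eq_sym (negPf gN).
pose T := mset_family w (fun=> 1%N).
have TS : (T `<=` S)%mset.
  apply/msubsetP => h; case: (boolP (h \in T)) => [|/mset_eq0P -> //].
  move=> /mem_mset_family[b ->]; rewrite mset_familyE //.
  by rewrite mset_gt0; case: b.
have Tw h : h \in T -> exists b, h = w b by apply: mem_mset_family.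
have [_ _ Smin'] := Smin.
case: (eqVmproper TS) => [<-|TSp].
  by rewrite (size_mset_family wI Tw) big_bool !mset_familyE.
case: (Smin' _ TSp).
  move=> /(congr1 (fun T : {mset G}%mset => T (w true))) /eqP.
  by rewrite mset_familyE // mset0E.
rewrite /zero_sum (sum_mset_family id wI Tw) big_bool !mset_familyE //.
by rewrite /= subrr.
Qed.

(** Without antipodal pairs, [S] contains at most one of the two signed indicators of [J]. This
    picks that one, and the positive one by default. *)
Definition signed_row (r : nat) (S : {mset 'rV[int]_r}%mset) (J : {set 'I_r}) :
    'rV[int]_r :=
  let v := \row_k (k \in J)%:R in if - v \in S then - v else v.

Lemma signed_rowE r (S : {mset 'rV[int]_r}%mset) J :
  exists s : int, s ^+ 2 = 1 /\
    forall k, signed_row S J 0 k = s * (k \in J)%:R.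
Proof.
rewrite /signed_row; case: ifP => _; [exists (-1)|exists 1];
  by split=> [|k]; rewrite ?sqrrN ?expr1n // !mxE ?mulN1r ?mul1r.
Qed.

Lemma signed_row_eq0 r (S : {mset 'rV[int]_r}%mset) J k :
  (signed_row S J 0 k == 0) = (k \notin J).
Proof.
have [s [s1 ->]] := signed_rowE S J; rewrite mulf_eq0.
have -> : (s == 0) = false by apply/eqP => s0; move: s1; rewrite s0 expr0n.
by case: (k \in J).
Qed.

Lemma signed_row_inj r (S : {mset 'rV[int]_r}%mset) : injective (signed_row S).
Proof.
move=> J K JK; apply/setP => k; apply: negb_inj.
by rewrite -!(signed_row_eq0 S) JK.
Qed.

Lemma Gpm_signed_row r (S : {mset 'rV[int]_r}%mset) :
  sequence_over (@Gpm r) S -> (forall g, g \in S -> - g \notin S) ->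
  forall g, g \in S ->
  exists2 J : {set 'I_r}, J != finset.set0 & g = signed_row S J.
Proof.
move=> SG noanti g gS; have /GpmP[eps [[i ei] gE]] := SG g gS.
exists [set k | eps k]%SET; first by apply/set0Pn; exists i; rewrite inE.
rewrite /signed_row.
have -> : \row_k (k \in [set k | eps k]%SET)%:R
    = \row_k (eps k)%:R :> 'rV[int]_r.
  by apply/rowP => k; rewrite !mxE inE.
case: gE => gE; rewrite -?gE ?gS //.
by rewrite gE in gS *; rewrite (negPf (noanti _ gS)).
Qed.

Definition nzsets (r : nat) := [set~ (finset.set0 : {set 'I_r})]%SET.

Lemma card_nzsets r : #|nzsets r| = (2 ^ r - 1)%N.
Proof.
rewrite cardsC1 -cardsT -powersetT.
by rewrite card_powerset cardsT card_ord subn1. Qed.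

Definition signed_mx (r : nat) (S : {mset 'rV[int]_r}%mset) :
    'M[int]_(#|nzsets r|, r) :=
  \matrix_(i, j) signed_row S (enum_val i) 0 j.

(** The rows of the singletons are the standard basis vectors up to sign. *)
Lemma rank_signed_mx (F : numFieldType) r (S : {mset 'rV[int]_r}%mset) :
  \rank (map_mx intr (signed_mx S) : 'M[F]_(_, _)) = r.
Proof.
apply/eqP; rewrite -/(row_full _) -sub1mx; apply/row_subP => j.
have jN : [set j]%SET \in nzsets r.
  by rewrite !inE; apply/set0Pn; exists j; rewrite inE.
have [s [s1 sE]] := signed_rowE S [set j]%SET.
have -> : row j 1%:M = s%:~R *: row (enum_rank_in jN [set j]%SET)
                                   (map_mx intr (signed_mx S)) :> 'rV[F]_r.
  apply/rowP => k; rewrite !mxE enum_rankK_in // sE inE.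
  rewrite rmorphM mulrA -rmorphM -expr2 s1 mul1r eq_sym.
  by rewrite rmorph_nat.
by rewrite scalemx_sub // row_sub.
Qed.

Lemma minimal_size_bound (R : realType) (r : nat) (b : R)
    (S : {mset 'rV[int]_r}%mset) :
  (2 <= r)%N -> 2 <= b ->
  (forall c : nat, (c ^ 2 * 4 ^ r <= r.+2 ^ r.+2)%N -> c%:R <= b) ->
  sequence_over (@Gpm r) S -> minimal_zero_sum S ->
  (size S)%:R <= (2 ^ r - 1 - r)%:R * b.
Proof.
move=> r2 b2 bP SG Smin.
have b0 : 0 <= b by apply: le_trans b2.
(* This needs [2 <= r]; it lets [b], and with it the length 2 of g(-g), fit under the final
   bound. *)
have N1 : (1 <= 2 ^ r - 1 - r)%N.
  elim: r r2 {S SG Smin bP} => // -[|[|r]] IH _ //.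
  by have := IH isT; rewrite (expnS 2 r.+2); move: (2 ^ r.+2)%N => x; lia.
have b_le : b <= (2 ^ r - 1 - r)%:R * b by rewrite ler_peMl // ler1n.
have [[g gS gNS]|noanti] := pselect (exists2 g, g \in S & - g \in S).
  rewrite (@antipodal_minimal_size _ S g) //; first exact: le_trans b2 b_le.
  have /GpmP[eps [[i ei] gE]] := SG g gS.
  apply/eqP => /rowP/(_ i); by case: gE => ->; rewrite !mxE ei.
have {}noanti g : g \in S -> - g \notin S.
  by move=> gS; apply/negP => gNS; apply: noanti; exists g.
pose w (i : 'I_#|nzsets r|) := signed_row S (enum_val i).
have wI : injective w by move=> i j /signed_row_inj/enum_val_inj.
have Sw g : g \in S -> exists i, g = w i.
  move=> /(Gpm_signed_row SG noanti)[J J0 ->].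
  have JN : J \in nzsets r by rewrite !inE.
  by exists (enum_rank_in JN J); rewrite /w enum_rankK_in.
pose A := signed_mx S.
have AE i j : A i j = w i 0 j by rewrite mxE.
have [s sP] : exists s : 'I_#|nzsets r| -> int, forall i,
    s i ^+ 2 = 1 /\ forall j, A i j = s i * (j \in (enum_val i : {set _}))%:R.
  apply: (fin_all_exists (P := fun i x => x ^+ 2 = 1 /\ forall j,
    A i j = x * (j \in (enum_val i : {set _}))%:R)) => i.
  have [x [x1 xE]] := signed_rowE S (enum_val i).
  by exists x; split=> // j; rewrite AE xE.
have kerE (c : 'I_#|nzsets r| -> nat) :
    (\row_i (c i)%:R : 'rV[R]_#|nzsets r|) *m map_mx intr A = 0 <->
    \sum_i w i *+ c i = 0.
  have rowE : (\row_i (c i)%:R : 'rV[R]_#|nzsets r|) *m map_mx intr A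
      = map_mx intr (\sum_i w i *+ c i).
    apply/rowP => j; rewrite !mxE summxE rmorph_sum; apply: eq_bigr => i _.
    by rewrite !mxE mulmxnE rmorphMn /= -AE mxE mulr_natl.
  rewrite rowE; split=> [/rowP e|->]; last by rewrite map_mx0.
  apply/rowP => j; have /eqP := e j.
  by rewrite !mxE intr_eq0 => /eqP.
pose u : 'rV[R]_#|nzsets r| := \row_i (S (w i))%:R.
have u0 i : 0 <= u 0 i by rewrite mxE ler0n.
have uA : u *m map_mx intr A = 0.
  have [_ + _] := Smin.
  by rewrite /zero_sum (sum_mset_family id wI Sw) => ?; apply/kerE.
have sizeE : (size S)%:R = \sum_i u 0 i.
  rewrite (size_mset_family wI Sw) natr_sum.
  by apply: eq_bigr => i _; rewrite mxE.
have := @greedy_sum_bound R _ _ (map_mx intr A) b b0 _ u u0 uA.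
case=> [v v0 vn0 vA|[c [c0 /kerE cA cb] cu]|].
- have [||c [c0 cA cv cb]] := @bounded_kernel_vector R _ _ A s v _ _ v0 vn0 vA.
  + by move=> i; case: (sP i).
  + move=> i j; have [_ ->] := sP i.
    by case: (j \in _); rewrite ?mulr1 ?mulr0; [right|left].
  + by exists c => //; split=> //; apply: bP.
(* A short vector below [u] is [u] itself, so the length is at most [b]. *)
- have cS := minimal_family wI Sw Smin _ c0 cA.
  rewrite (size_mset_family wI Sw) (eq_bigr c) => [|i _].
    exact: le_trans cb b_le.
  by rewrite cS // => j; have := cu j; rewrite mxE ler_nat.
by rewrite rank_signed_mx -sizeE card_nzsets.
Qed.

Theorem theorem3p13 (R : realType) (r : nat) (hr : (2 <= r)%N) :
  [/\ (((fib (r + 2))%:R : R)%:E <= Davenport R (@Gpm r))%E,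
      (Davenport R (@Gpm r) <=
        (((2 ^+ r - r%:R - 1) / 2 ^+ r)
          * powR (r%:R + 2) ((r%:R + 2) / 2) : R)%:E)%E
    & ((2 ^+ r - r%:R - 1) / 2 ^+ r)
          * powR (r%:R + 2) ((r%:R + 2) / 2)
        <= powR (r%:R + 2) ((r%:R + 2) / 2) :> R].
Proof.
set p := powR _ _; set e : R := _ / _.
have p0 : 0 <= p by apply: powR_ge0.
have pow2_gt0 : 0 < 2 ^+ r :> R by rewrite exprn_gt0.
have p2 : p ^+ 2 = (r.+2 ^ r.+2)%:R.
  rewrite natrX -powR_mulrn // -powRrM divfK // -powR_mulrn ?ler0n //.
  by rewrite -[r.+2]addn2 natrD.
have rN : (r.+1 <= 2 ^ r)%N by rewrite ltn_expl.
have eE : e = (2 ^ r - 1 - r)%:R / 2 ^+ r.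
  by rewrite -subnDA addnC addn1 natrB // -natr1 natrX opprD addrA.
pose b := p / 2 ^+ r.
have epE : e * p = (2 ^ r - 1 - r)%:R * b by rewrite eE mulrAC -mulrA.
have b0 : 0 <= b by rewrite divr_ge0 // ltW.
have bP (c : nat) : (c ^ 2 * 4 ^ r <= r.+2 ^ r.+2)%N -> c%:R <= b.
  move=> cr; have pow2_ge0 := ltW pow2_gt0.
  rewrite ler_pdivlMr // -ler_sqr ?nnegrE ?mulr_ge0 ?ler0n //.
  by rewrite p2 exprMn -!natrX -natrM ler_nat -expnM (mulnC r) expnM.
split.
- by apply: Davenport_Gpm_ge_fib; apply: leq_trans hr.
- apply: Davenport_le => [|S SG Smin]; rewrite epE; first by rewrite mulr_ge0.
  (* [2 <= b] amounts to 4^(r+1) <= (r+2)^(r+2), which holds as r + 2 is at least 4. *)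
  apply: minimal_size_bound => //; apply: (bP 2%N).
  rewrite -[(2 ^ 2)%N]/4%N -expnS.
  by rewrite (leq_trans (n := r.+2 ^ r.+1)) ?leq_exp2r ?leq_exp2l.
- rewrite ler_piMl // /e ler_pdivrMr // mul1r.
  by rewrite -addrA gerDl -opprD oppr_le0 addr_ge0.
Qed.
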